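(* Let $p\ge2$ be an integer, $q=e^{i\pi/p}$ (with $i$ here the imaginary unit), and let $1\le i\le p-1$ be an integer. Let $\theta: X^{\otimes(2p-i-1)}\to\mathcal{P}^+_i\to\mathcal{X}^+_i\to X^{\otimes(i-1)}$ be the composite $\bar U_q(\mathfrak{sl}_2)$-homomorphism described in the context. Then, up to a nonzero constant, $\theta$ is given diagrammatically by $$(1^{\otimes(i-1)}\otimes\cup^{(p-i)})\,(f_{p-1}\otimes 1^{\otimes(p-i)}):X^{\otimes(2p-i-1)}\to X^{\otimes(i-1)},$$ i.e. this operator equals a nonzero scalar multiple of $\theta$.
   Context: $\bar U_q(\mathfrak{sl}_2)$ is the Hopf algebra over a field $\mathbb{K}$ (containing $q$, e.g. $\mathbb{C}$) generated by $E,F,K$ with $KEK^{-1}=q^2E$, $KFK^{-1}=q^{-2}F$, $EF-FE=\frac{K-K^{-1}}{q-q^{-1}}$, $E^p=F^p=0$, $K^{2p}=1$, $\Delta E=E\otimes K+1\otimes E$, $\Delta F=F\otimes 1+K^{-1}\otimes F$, $\Delta K=K\otimes K$. Put $[n]=\frac{q^n-q^{-n}}{q-q^{-1}}$, $[n]!=[1]\cdots[n]$. $X=\mathcal{X}^+_2$ has basis $\nu_0,\nu_1$ with $K\nu_0=q\nu_0$, $K\nu_1=q^{-1}\nu_1$, $E\nu_0=0$, $E\nu_1=\nu_0$, $F\nu_0=\nu_1$, $F\nu_1=0$. For $1\le i_1<\dots<i_n\le z$, $\rho_{i_1,\dots,i_n,z}\in X^{\otimes z}$ is the basis tensor with $\nu_1$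 in positions $i_1,\dots,i_n$ and $\nu_0$ elsewhere; $x_{0,z}=\nu_0^{\otimes z}$. $\mathcal{X}^+_i$ is the simple module with basis $z_0,\dots,z_{i-1}$ and $Kz_k=q^{i-1-2k}z_k$, $Ez_k=[k][i-k]z_{k-1}$, $Fz_k=z_{k+1}$ ($z_{-1}=z_i=0$). $\mathcal{P}^+_i$ is the $2p$-dimensional indecomposable projective module with basis $\{a_k,b_k\}_{0\le k\le i-1}\cup\{x_j,y_j\}_{0\le j\le p-i-1}$ and action $Ka_k=q^{i-1-2k}a_k$, $Kb_k=q^{i-1-2k}b_k$, $Kx_j=-q^{p-i-1-2j}x_j$, $Ky_j=-q^{p-i-1-2j}y_j$; $Ea_k=[k][i-k]a_{k-1}$, $Eb_k=[k][i-k]b_{k-1}+a_{k-1}$ ($k\ge1$), $Eb_0=x_{p-i-1}$, $Ex_j=-[j][p-i-j]x_{j-1}$, $Ey_j=-[j][p-i-j]y_{j-1}$ ($j\ge1$), $Ey_0=a_{i-1}$; $Fa_k=a_{k+1}$, $Fb_k=b_{k+1}$ ($k<i-1$), $Fb_{i-1}=y_0$, $Fx_j=x_{j+1}$ ($j<p-i-1$), $Fx_{p-i-1}=a_0$, $Fy_j=y_{j+1}$, with $x_{-1}=a_{-1}=a_i=y_{p-i}=0$. The three maps composing $\theta$: (i) the projection $X^{\otimes(2p-i-1)}\to\mathcal{P}^+_i$, which modulo the span of the $a_k,x_j,y_j$ is given, for $p-i\le n\le p-1$, by $$\rho_{i_1,\dots,i_n,2p-i-1}\mapsto(-1)^{p-i-1}q^{\,n(2p-i-1)-\frac12(n^2-n)-\sum_{j=1}^n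 i_j}\,\frac{[n]!\,[p-n-1]!}{[n+i-p]!\,[i-1]!\,([p-i-1]!)^2}\;b_{n+i-p},$$ and by $0$ for all other $n$; (ii) $\mathcal{P}^+_i\to\mathcal{X}^+_i$: $x_j,a_k,y_j\mapsto0$, $b_k\mapsto z_k$; (iii) $\mathcal{X}^+_i\to X^{\otimes(i-1)}$: $z_k\mapsto F^kx_{0,i-1}$. Diagrams act as follows (composition right to left, $1$ is the identity strand): $\cup:X\otimes X\to\mathbb{K}$, $\cup(\nu_0\otimes\nu_0)=\cup(\nu_1\otimes\nu_1)=0$, $\cup(\nu_0\otimes\nu_1)=-q$, $\cup(\nu_1\otimes\nu_0)=1$; $\cap:\mathbb{K}\to X\otimes X$, $\cap(1)=q^{-1}\nu_1\otimes\nu_0-\nu_0\otimes\nu_1$. $\cup^{(m)}:X^{\otimes2m}\to\mathbb{K}$ is the nested $m$-fold cup, pairing position $k$ with position $2m+1-k$. $f_n$ is the Jones–Wenzl projection on $X^{\otimes n}$ (for $n\le p-1$): $f_1=1$, $f_n=f_{n-1}\otimes1-\frac{[n-1]}{[n]}(f_{n-1}\otimes1)\mathbf{e}_{n-1}(f_{n-1}\otimes1)$, where $\mathbf{e}_k=1^{\otimes(k-1)}\otimes\cap\cup\otimes1^{\otimes(n-k-1)}$. *)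

(* Defs.v *)
From HB Require Import structures.
From mathcomp Require Import all_boot all_order all_algebra.
From mathcomp Require Import reals trigo.
From mathcomp Require Export complex.
From mathcomp Require Import zify.

Set Implicit Arguments.
Unset Strict Implicit.
Unset Printing Implicit Defensive.

Import Order.TTheory GRing.Theory Num.Theory.
Local Open Scope ring_scope.

Definition exp_i_pi_over (R : realType) (p : nat) : R[i] :=
  Complex (cos (pi / p%:R)) (sin (pi / p%:R)).

Section FreeModules.
Variable K : fieldType.

Definition bvec (B : finType) (b : B) : {ffun B -> K^o} :=
  [ffun b' => (b' == b)%:R].

(* The linear map with prescribed values [g] on the basis [bvec b]. *)
Definition lext (B : finType) (W : lmodType K) (g : B -> W)
  (v : {ffun B -> K^o}) : W := \sum_(b : B) (v b : K) *: g b.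

End FreeModules.

(* The action of the generators E, F, K on a module.  The defining relations
   are not recorded: they play no role in the notion of homomorphism, since a
   linear map is a homomorphism iff it commutes with the generators. *)
Record Uq_action (K : fieldType) := UqAction {
  Uq_carrier :> lmodType K;
  Uq_E : Uq_carrier -> Uq_carrier;
  Uq_F : Uq_carrier -> Uq_carrier;
  Uq_K : Uq_carrier -> Uq_carrier
}.

Definition Uq_hom (K : fieldType) (V W : Uq_action K)
    (f : {linear V -> W}) : Prop :=
  [/\ forall v, f (Uq_E v) = Uq_E (f v),
      forall v, f (Uq_F v) = Uq_F (f v)
    & forall v, f (Uq_K v) = Uq_K (f v)].

Section TensorPowers.
Variable K : fieldType.

(* [w : word n] encodes the basis tensor of X^{(x)n} with nu_1 at the positions
   where [w] is true and nu_0 elsewhere.  Positions are numbered from 0, so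
   [j : 'I_n] is the (j + 1)-st tensor factor from the left. *)
Definition word (n : nat) : Type := {ffun 'I_n -> bool}.

Definition X (n : nat) : Type := {ffun word n -> K^o}.

Definition rho (n : nat) (w : word n) : X n := bvec K w.

Definition x0 (n : nat) : X n := rho [ffun=> false].

Definition lword (m n : nat) (w : word (m + n)) : word m :=
  [ffun j => w (lshift n j)].
Definition rword (m n : nat) (w : word (m + n)) : word n :=
  [ffun j => w (rshift m j)].

Definition tensv (m n : nat) (u : X m) (v : X n) : X (m + n) :=
  [ffun w => (u (lword w) : K) * v (rword w)].

Definition tens (m m' n n' : nat) (f : X m -> X m') (g : X n -> X n') :
    X (m + n) -> X (m' + n') :=
  lext (fun w : word (m + n) => tensv (f (rho (lword w))) (g (rho (rword w)))).

Definition castX (m n : nat) (e : m = n) (v : X m) : X n :=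
  [ffun w : word n => v [ffun j => w (cast_ord e j)]].

Definition castop (m n : nat) (e : m = n) (f : X m -> X m) : X n -> X n :=
  castX e \o f \o castX (esym e).

End TensorPowers.

Section QuantumGroup.
Variables (K : fieldType) (q : K).

Definition qint (n : nat) : K := (q ^+ n - q ^- n) / (q - q^-1).
Definition qfact (n : nat) : K := \prod_(1 <= k < n.+1) qint k.

Definition E1 : X K 1 -> X K 1 :=
  lext (fun w : word 1 => if w ord0 then x0 K 1 else 0).
Definition F1 : X K 1 -> X K 1 :=
  lext (fun w : word 1 => if w ord0 then 0 else rho K [ffun=> true]).
Definition K1 : X K 1 -> X K 1 :=
  lext (fun w : word 1 => (if w ord0 then q^-1 else q) *: rho K w).
Definition K1inv : X K 1 -> X K 1 :=
  lext (fun w : word 1 => (if w ord0 then q else q^-1) *: rho K w).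

(* On X^{(x)(n+1)} = X (x) X^{(x)n} the generators act through the coproduct
   E |-> E (x) K + 1 (x) E,  F |-> F (x) 1 + K^-1 (x) F,  K |-> K (x) K,
   and on X^{(x)0} through the counit. *)
Fixpoint Kten (n : nat) : X K n -> X K n :=
  if n is m.+1 then tens (m := 1) (m' := 1) K1 (@Kten m) else id.
Fixpoint Eten (n : nat) : X K n -> X K n :=
  if n is m.+1 then
    fun v => tens (m := 1) (m' := 1) E1 (@Kten m) v
             + tens (m := 1) (m' := 1) id (@Eten m) v
  else fun=> 0.
Fixpoint Ften (n : nat) : X K n -> X K n :=
  if n is m.+1 then
    fun v => tens (m := 1) (m' := 1) F1 id v
             + tens (m := 1) (m' := 1) K1inv (@Ften m) v
  else fun=> 0.

Definition Xmod (n : nat) : Uq_action K :=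
  UqAction (@Eten n) (@Ften n) (@Kten n).

(* The basis vector z_k of the simple module X^+_i, and 0 if k >= i. *)
Definition zvec (i k : nat) : {ffun 'I_i -> K^o} :=
  [ffun j : 'I_i => (j == k :> nat)%:R].

Definition Smod (i : nat) : Uq_action K :=
  @UqAction K {ffun 'I_i -> K^o}
    (lext (fun k : 'I_i => (qint k * qint (i - k)) *: zvec i k.-1))
    (lext (fun k : 'I_i => zvec i k.+1))
    (lext (fun k : 'I_i => q ^ (i%:Z - 1 - (2 * k)%N%:Z) *: zvec i k)).

Section Projective.
Variables p i : nat.

(* Basis labels of P^+_i, in the order (a + b) + (x + y). *)
Definition Pbasis : finType :=
  (('I_i + 'I_i) + ('I_(p - i) + 'I_(p - i)))%type.
Definition Pspace : lmodType K := {ffun Pbasis -> K^o}.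

(* The basis vectors a_k, b_k, x_k, y_k, and 0 if the index is too large. *)
Definition avec (k : nat) : Pspace :=
  [ffun s : Pbasis =>
    (if s is inl (inl j) then (j == k :> nat)%:R else 0) : K^o].
Definition bbvec (k : nat) : Pspace :=
  [ffun s : Pbasis =>
    (if s is inl (inr j) then (j == k :> nat)%:R else 0) : K^o].
Definition xvec (k : nat) : Pspace :=
  [ffun s : Pbasis =>
    (if s is inr (inl j) then (j == k :> nat)%:R else 0) : K^o].
Definition yvec (k : nat) : Pspace :=
  [ffun s : Pbasis =>
    (if s is inr (inr j) then (j == k :> nat)%:R else 0) : K^o].

Definition PE (s : Pbasis) : Pspace :=
  match s with
  | inl (inl k) => (qint k * qint (i - k)) *: avec k.-1
  | inl (inr k) =>
      if k == 0 :> nat then xvec (p - i - 1)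
      else (qint k * qint (i - k)) *: bbvec k.-1 + avec k.-1
  | inr (inl j) => - (qint j * qint (p - i - j)) *: xvec j.-1
  | inr (inr j) =>
      if j == 0 :> nat then avec i.-1
      else - (qint j * qint (p - i - j)) *: yvec j.-1
  end.

Definition PF (s : Pbasis) : Pspace :=
  match s with
  | inl (inl k) => avec k.+1
  | inl (inr k) => if (k < i - 1)%N then bbvec k.+1 else yvec 0
  | inr (inl j) => if (j < p - i - 1)%N then xvec j.+1 else avec 0
  | inr (inr j) => yvec j.+1
  end.

Definition PK (s : Pbasis) : Pspace :=
  match s with
  | inl (inl k) => q ^ (i%:Z - 1 - (2 * k)%N%:Z) *: avec k
  | inl (inr k) => q ^ (i%:Z - 1 - (2 * k)%N%:Z) *: bbvec k
  | inr (inl j) => - q ^ (p%:Z - i%:Z - 1 - (2 * j)%N%:Z) *: xvec j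
  | inr (inr j) => - q ^ (p%:Z - i%:Z - 1 - (2 * j)%N%:Z) *: yvec j
  end.

Definition Pmod : Uq_action K :=
  @UqAction K Pspace (lext PE) (lext PF) (lext PK).

Definition in_span_axy (u : Pspace) : Prop :=
  exists (al : 'I_i -> K) (xi et : 'I_(p - i) -> K),
    u = \sum_k al k *: avec k + \sum_j xi j *: xvec j + \sum_j et j *: yvec j.

Definition nu1_count (n : nat) (w : word n) : nat := #|[pred j | w j]|.
Definition nu1_sum (n : nat) (w : word n) : nat := (\sum_(j < n | w j) j.+1)%N.

Definition proj_coef (w : word (2 * p - i - 1)) : K :=
  let n := nu1_count w in
  (-1) ^+ (p - i - 1)
  * q ^ ((n * (2 * p - i - 1))%N%:Z - ((n ^ 2 - n) %/ 2)%N%:Z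
         - (nu1_sum w)%:Z)
  * (qfact n * qfact (p - n - 1)
     / (qfact (n + i - p) * qfact (i - 1) * qfact (p - i - 1) ^+ 2)).

(* [phi] is a homomorphism with the prescribed values modulo the span of the
   a_k, x_j, y_j; these values determine [phi] only modulo that span. *)
Definition is_projection (phi : {linear Xmod (2 * p - i - 1) -> Pmod}) : Prop :=
  Uq_hom phi /\
  forall w : word (2 * p - i - 1),
    let n := nu1_count w in
    in_span_axy
      (phi (rho K w)
       - (if (p - i <= n <= p - 1)%N then proj_coef w *: bbvec (n + i - p)
          else 0)).

Definition P_to_S : Pmod -> Smod i :=
  lext (fun s : Pbasis => if s is inl (inr k) then zvec i k else 0).

Definition S_to_X : Smod i -> Xmod (i - 1) :=
  lext (fun k : 'I_i => iter k (@Uq_F K (Xmod (i - 1))) (x0 K (i - 1))).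

Definition theta (phi : {linear Xmod (2 * p - i - 1) -> Pmod}) :
    Xmod (2 * p - i - 1) -> Xmod (i - 1) :=
  S_to_X \o P_to_S \o phi.

End Projective.

Definition cup_coef (s t : bool) : K :=
  match s, t with
  | false, true => - q
  | true, false => 1
  | _, _ => 0
  end.

Definition cup : X K 2 -> X K 0 :=
  lext (fun w : word 2 => cup_coef (w ord0) (w ord_max) *: x0 K 0).

Definition pair_word (s t : bool) : word 2 :=
  [ffun j => if j == ord0 then s else t].

Definition cap : X K 0 -> X K 2 :=
  lext (fun _ : word 0 => q^-1 *: rho K (pair_word true false)
              - rho K (pair_word false true)).

(* The 0-based position k is paired with 2m - 1 - k. *)
Definition nested_cup (m : nat) : X K (m + m) -> X K 0 :=
  lext (fun w : word (m + m) =>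
    (\prod_(k < m) cup_coef (w (lshift m k)) (w (rshift m (rev_ord k))))
      *: x0 K 0).

(* 1^{(x)n} (x) cap cup, that is e_{n+1} on n + 2 strands. *)
Definition e_last (n : nat) : X K n.+2 -> X K n.+2 :=
  castop (addn2 n) (tens (m := n) (m' := n) id (cap \o cup)).

Definition add_strand (n : nat) (f : X K n -> X K n) : X K n.+1 -> X K n.+1 :=
  castop (addn1 n) (tens (n := 1) (n' := 1) f id).

(* The value at n = 0 is a convention. *)
Fixpoint jones_wenzl (n : nat) : X K n -> X K n :=
  match n with
  | 0 => id
  | m.+1 =>
    match m return (X K m -> X K m) -> X K m.+1 -> X K m.+1 with
    | 0 => fun=> id
    | l.+1 => fun f v =>
        let g := add_strand f in
        g v - (qint l.+1 / qint l.+2) *: g (@e_last l (g v))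
    end (@jones_wenzl m)
  end.

Lemma source_size (p i : nat) : (1 <= i <= p - 1)%N ->
  (2 * p - i - 1 = (p - 1) + (p - i))%N.
Proof. lia. Qed.

Lemma middle_size (p i : nat) : (1 <= i <= p - 1)%N ->
  ((p - 1) + (p - i) = (i - 1) + ((p - i) + (p - i)))%N.
Proof. lia. Qed.

Definition theta_diagram (p i : nat) (hi : (1 <= i <= p - 1)%N) :
    X K (2 * p - i - 1) -> X K (i - 1) :=
  castX (addn0 (i - 1)%N)
  \o tens (m := (i - 1)%N) (m' := (i - 1)%N) id (@nested_cup (p - i))
  \o castX (middle_size hi)
  \o tens (n := (p - i)%N) (n' := (p - i)%N) (@jones_wenzl (p - 1)) id
  \o castX (source_size hi).

End QuantumGroup.

(* Main.v *)
(** Let [u_k] be the weight vector of X^(x)n that gives [w] with [k] letters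
    nu_1 the coefficient q^-(sum of the positions of nu_1 in [w]).  Then F^k x_0
    is a multiple of [u_k], and f_n sends [rho w] to a multiple of [u_k], so
    both operators send [rho w] to a multiple of one and the same [u_k] in
    X^(x)(i-1): for the diagram, the nested cup selects the unique word on the
    middle p - i strands that is the reversed complement of the last p - i
    letters of [w].  The multiples agree up to a constant because q^p = -1 gives
    [p - k] = [k], whence [n]! [p-1-n]! = [p-1]! for all n < p. *)
Require Import Defs.
From HB Require Import structures.
From mathcomp Require Import all_boot all_order all_algebra.
From mathcomp Require Import reals complex trigo.
From mathcomp Require Import zify ring.
Import Order.TTheory GRing.Theory Num.Theory.
Local Open Scope ring_scope.

Set Implicit Arguments.
Unset Strict Implicit.
Unset Printing Implicit Defensive.

(** * Linear maps out of free modules *)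

Section LinearMaps.
Variable K : fieldType.

Section Lin.
Variables (U V : lmodType K) (f : U -> V) (hf : linear f).

(** The operators are plain functions whose linearity is a separate hypothesis; packing it here
    gives access to the library's theory of linear maps. *)
Let fL : {linear U -> V} := HB.pack f (GRing.isLinear.Build K U V *:%R f hf).

Lemma lin_scale a u : f (a *: u) = a *: f u.
Proof. exact: (linearZ_LR fL). Qed.
Lemma lin_add u v : f (u + v) = f u + f v.
Proof. exact: (linearD fL). Qed.
Lemma lin_sub u v : f (u - v) = f u - f v.
Proof. exact: (linearB fL). Qed.
Lemma lin_zero : f 0 = 0.
Proof. exact: (linear0 fL). Qed.
Lemma lin_sum (I : finType) (v : I -> U) : f (\sum_i v i) = \sum_i f (v i).
Proof. exact: (linear_sum fL). Qed.
End Lin.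

Lemma lin_comp (U V W : lmodType K) (f : V -> W) (g : U -> V) :
  linear f -> linear g -> linear (f \o g).
Proof. by move=> hf hg a u v; rewrite /= hg hf. Qed.

Lemma lin_lext (B : finType) (W : lmodType K) (g : B -> W) :
  linear (lext (K := K) g).
Proof.
move=> a u v; rewrite /lext scaler_sumr -big_split; apply: eq_bigr => b _.
by rewrite !ffunE scalerDl scalerA.
Qed.

Lemma lext_bvec (B : finType) (W : lmodType K) (g : B -> W) (b : B) :
  lext g (bvec K b) = g b.
Proof.
rewrite /lext (bigD1 b) //= ffunE eqxx scale1r big1 ?addr0 // => c cb.
by rewrite ffunE (negPf cb) scale0r.
Qed.

Lemma bvec_expand (B : finType) (v : {ffun B -> K^o}) :
  v = \sum_b (v b : K) *: bvec K b.
Proof.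
apply/ffunP => b; rewrite sum_ffunE (bigD1 b) //= !ffunE eqxx big1.
  by rewrite addr0 /GRing.scale /= mulr1.
by move=> c cb; rewrite !ffunE eq_sym (negPf cb) /GRing.scale /= mulr0.
Qed.

Lemma lin_expand (B : finType) (W : lmodType K) (f : {ffun B -> K^o} -> W)
    (v : {ffun B -> K^o}) :
  linear f -> f v = \sum_b (v b : K) *: f (bvec K b).
Proof.
move=> hf; rewrite {1}[v]bvec_expand lin_sum //.
by apply: eq_bigr => b _; rewrite lin_scale.
Qed.

End LinearMaps.

(** * Words, concatenation and tensor products of vectors *)

Section Words.
Variable K : fieldType.

Definition catw (m n : nat) (a : word m) (b : word n) : word (m + n) :=
  [ffun j => match split j with inl k => a k | inr k => b k end].

Lemma catw_lshift m n (a : word m) (b : word n) j : catw a b (lshift n j) = a j.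
Proof. by rewrite ffunE (unsplitK (inl j)). Qed.

Lemma catw_rshift m n (a : word m) (b : word n) j : catw a b (rshift m j) = b j.
Proof. by rewrite ffunE (unsplitK (inr j)). Qed.

Lemma lword_catw m n (a : word m) (b : word n) : lword (catw a b) = a.
Proof. by apply/ffunP => j; rewrite ffunE catw_lshift. Qed.

Lemma rword_catw m n (a : word m) (b : word n) : rword (catw a b) = b.
Proof. by apply/ffunP => j; rewrite ffunE catw_rshift. Qed.

Lemma catw_lrword m n (w : word (m + n)) : catw (lword w) (rword w) = w.
Proof.
apply/ffunP => j; rewrite ffunE -{2}(splitK j).
by case: (split j) => k; rewrite ffunE.
Qed.

Lemma sum_word_cat (V : nmodType) m n (G : word (m + n) -> V) :
  \sum_w G w = \sum_a \sum_b G (catw a b).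
Proof.
rewrite pair_big /= (reindex (fun ab : word m * word n => catw ab.1 ab.2)) //=.
exists (fun w => (lword w, rword w)) => [[a b] _|w _] /=.
  by rewrite lword_catw rword_catw.
exact: catw_lrword.
Qed.

(** The transport of words matching [castX] on basis tensors: casts move from vectors to words,
    where the letter count and the position sum are invariant. *)
Definition castw m n (e : m = n) (w : word m) : word n :=
  [ffun j => w (cast_ord (esym e) j)].

Lemma castXE m n (e : m = n) (v : X K m) (w : word n) :
  castX e v w = v (castw (esym e) w).
Proof.
by rewrite ffunE; congr (v _); apply/ffunP => j; rewrite !ffunE esymK.
Qed.

Lemma castw_id n (e : n = n) (w : word n) : castw e w = w.
Proof. by apply/ffunP => j; rewrite ffunE cast_ord_id. Qed.

Lemma castwK m n (e : m = n) : cancel (castw e) (castw (esym e)).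
Proof. by case: _ / e => w; rewrite !castw_id. Qed.

Lemma castwVK m n (e : m = n) : cancel (castw (esym e)) (castw e).
Proof. by case: _ / e => w; rewrite !castw_id. Qed.

Lemma lin_castX m n (e : m = n) : linear (castX e : X K m -> X K n).
Proof. by move=> a u v; apply/ffunP => w; rewrite !ffunE. Qed.

Lemma castX_rho m n (e : m = n) (w : word m) :
  castX e (rho K w) = rho K (castw e w).
Proof.
case: _ / e; rewrite castw_id; apply/ffunP => x.
by rewrite castXE castw_id.
Qed.

Lemma castXK m n (e : m = n) (v : X K m) : castX (esym e) (castX e v) = v.
Proof. by case: _ / e; apply/ffunP => w; rewrite !castXE !castw_id. Qed.

Lemma count_castw m n (e : m = n) (w : word m) :
  nu1_count (castw e w) = nu1_count w.
Proof. by case: _ / e; rewrite castw_id. Qed.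

Lemma sum_castw m n (e : m = n) (w : word m) :
  nu1_sum (castw e w) = nu1_sum w.
Proof. by case: _ / e; rewrite castw_id. Qed.

Lemma nu1_countE n (w : word n) : nu1_count w = (\sum_j w j)%N.
Proof.
by rewrite /nu1_count -sum1_card big_mkcond; apply: eq_bigr => j _; rewrite inE; case: (w j).
Qed.

Lemma nu1_sumE n (w : word n) : nu1_sum w = (\sum_j w j * j.+1)%N.
Proof.
by rewrite /nu1_sum big_mkcond; apply: eq_bigr => j _; case: (w j); rewrite ?mul1n.
Qed.

Lemma nu1_count_lr m n (w : word (m + n)) :
  nu1_count w = (nu1_count (lword w) + nu1_count (rword w))%N.
Proof.
rewrite !nu1_countE big_split_ord.
by congr addn; apply: eq_bigr => j _; rewrite ffunE.
Qed.

Lemma nu1_sum_lr m n (w : word (m + n)) :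
  nu1_sum w = (nu1_sum (lword w) + nu1_sum (rword w)
               + m * nu1_count (rword w))%N.
Proof.
rewrite !nu1_sumE nu1_countE big_split_ord -addnA; congr addn.
  by apply: eq_bigr => j _; rewrite ffunE.
rewrite big_distrr -big_split; apply: eq_bigr => j _ /=.
by rewrite ffunE; lia.
Qed.

Lemma nu1_count_le n (w : word n) : (nu1_count w <= n)%N.
Proof. by rewrite -[leqRHS]card_ord; apply: max_card. Qed.

Lemma word1E (w : word 1) : w = [ffun=> w ord0].
Proof. by apply/ffunP => j; rewrite ffunE ord1. Qed.

Lemma nu1_count1 (w : word 1) : nu1_count w = w ord0.
Proof. by rewrite nu1_countE big_ord1. Qed.

Lemma nu1_sum1 (w : word 1) : nu1_sum w = w ord0.
Proof. by rewrite nu1_sumE big_ord1 muln1. Qed.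

Lemma nu1_count_eq0 n (w : word n) : (nu1_count w == 0) = (w == [ffun=> false]).
Proof.
rewrite nu1_countE sum_nat_eq0; apply/forallP/eqP => [h|-> j]; last by rewrite ffunE.
by apply/ffunP => j; rewrite ffunE; move: (h j); case: (w j).
Qed.

Definition letter (s : bool) : word 1 := [ffun=> s].

Lemma letter_eq (w : word 1) s : (w == letter s) = (w ord0 == s).
Proof.
apply/eqP/eqP => [->|h]; first by rewrite ffunE.
by rewrite [w]word1E h.
Qed.

Lemma tensvDl m n (u u' : X K m) (v : X K n) :
  tensv (u + u') v = tensv u v + tensv u' v.
Proof. by apply/ffunP => w; rewrite !ffunE mulrDl. Qed.
Lemma tensvDr m n (u : X K m) (v v' : X K n) :
  tensv u (v + v') = tensv u v + tensv u v'.
Proof. by apply/ffunP => w; rewrite !ffunE mulrDr. Qed.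
Lemma tensvZl m n a (u : X K m) (v : X K n) :
  tensv (a *: u) v = a *: tensv u v.
Proof. by apply/ffunP => w; rewrite !ffunE /GRing.scale /= mulrA. Qed.
Lemma tensvZr m n a (u : X K m) (v : X K n) :
  tensv u (a *: v) = a *: tensv u v.
Proof. by apply/ffunP => w; rewrite !ffunE /GRing.scale /= mulrCA. Qed.

Lemma lin_tens m m' n n' (f : X K m -> X K m') (g : X K n -> X K n') :
  linear (tens f g).
Proof. exact: lin_lext. Qed.

(** [tens] is defined on basis words only; expanding [u] and [v] on the basis turns each coefficient
    into a double sum that factors. *)
Lemma tens_tensv m m' n n' (f : X K m -> X K m') (g : X K n -> X K n')
    (u : X K m) (v : X K n) : linear f -> linear g ->
  tens f g (tensv u v) = tensv (f u) (g v).
Proof.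
move=> hf hg; rewrite /tens /lext sum_word_cat.
apply/ffunP => w; rewrite ffunE (lin_expand u hf) (lin_expand v hg) !sum_ffunE.
rewrite big_distrl; apply: eq_bigr => a _ /=.
rewrite big_distrr sum_ffunE; apply: eq_bigr => b _ /=.
rewrite !ffunE !lword_catw !rword_catw /GRing.scale /= /rho.
by rewrite mulrACA.
Qed.

Lemma tens_rho m m' n n' (f : X K m -> X K m') (g : X K n -> X K n')
    (w : word (m + n)) :
  tens f g (rho K w) = tensv (f (rho K (lword w))) (g (rho K (rword w))).
Proof. exact: lext_bvec. Qed.

(** The Jones-Wenzl recursion adds strands on the right, while the coproduct splits off the leftmost
    factor. Hence words are also taken apart at their last letter. *)
Definition snocw n (a : word n) (s : bool) : word n.+1 :=
  castw (addn1 n) (catw a (letter s)).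

Lemma snocw_l n (a : word n) s (j : 'I_n.+1) (k : 'I_n) :
  j = k :> nat -> snocw a s j = a k.
Proof.
move=> jk; rewrite ffunE.
have -> : cast_ord (esym (addn1 n)) j = lshift 1 k by apply: val_inj.
by rewrite ffunE (unsplitK (inl k)).
Qed.

Lemma snocw_r n (a : word n) s (j : 'I_n.+1) : j = n :> nat -> snocw a s j = s.
Proof.
move=> jn; rewrite ffunE.
have -> : cast_ord (esym (addn1 n)) j = rshift n ord0.
  by apply: val_inj; rewrite /= jn addn0.
by rewrite ffunE (unsplitK (inr ord0)) ffunE.
Qed.

Lemma word_snoc n (w : word n.+1) : exists a s, w = snocw a s.
Proof.
set w' : word (n + 1) := castw (esym (addn1 n)) w.
exists (lword w'), (rword w' ord0).
by rewrite /snocw /letter -word1E catw_lrword castwVK.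
Qed.

Lemma count_snocw n (a : word n) s : nu1_count (snocw a s) = (nu1_count a + s)%N.
Proof.
by rewrite count_castw nu1_count_lr lword_catw rword_catw nu1_count1 ffunE.
Qed.

Lemma sum_snocw n (a : word n) s : nu1_sum (snocw a s) = (nu1_sum a + s * n.+1)%N.
Proof.
rewrite sum_castw nu1_sum_lr lword_catw rword_catw nu1_count1 nu1_sum1 ffunE.
by lia.
Qed.

Definition snocv n (v : X K n) (s : bool) : X K n.+1 :=
  castX (addn1 n) (tensv v (rho K (letter s))).

Lemma snocvE n (v : X K n) s (a : word n) t :
  snocv v s (snocw a t) = if t == s then v a else 0.
Proof.
rewrite /snocv castXE castwK ffunE.
rewrite lword_catw rword_catw /rho [bvec K _ _]ffunE letter_eq ffunE.
by case: eqP; rewrite ?mulr1 ?mulr0.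
Qed.

Lemma lin_snocv n s : linear (fun v : X K n => snocv v s).
Proof.
by move=> a u v; rewrite /snocv tensvDl tensvZl lin_castX.
Qed.

Lemma snocvD n (u v : X K n) s : snocv (u + v) s = snocv u s + snocv v s.
Proof. exact: (lin_add (@lin_snocv n s)). Qed.
Lemma snocvZ n a (v : X K n) s : snocv (a *: v) s = a *: snocv v s.
Proof. exact: (lin_scale (@lin_snocv n s)). Qed.
Lemma snocv0 n s : snocv (0 : X K n) s = 0.
Proof. exact: (lin_zero (@lin_snocv n s)). Qed.

Lemma snocv_rho n (a : word n) (s : bool) :
  snocv (rho K a) s = rho K (snocw a s).
Proof.
rewrite /snocv -castX_rho; congr castX; apply/ffunP => w.
rewrite !ffunE -natrM mulnb; congr (_%:R); congr nat_of_bool.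
apply/andP/eqP => [[/eqP <- /eqP <-]|->]; first by rewrite catw_lrword.
by rewrite lword_catw rword_catw !eqxx.
Qed.

End Words.

(** * The weight vectors u_k and the action of F on them *)

Section WeightVectors.
Variables (K : fieldType) (q : K).

Definition uvec (n k : nat) : X K n :=
  [ffun w => if nu1_count w == k then q^-1 ^+ nu1_sum w else 0].

Lemma uvecE n k w :
  uvec n k w = if nu1_count w == k then q^-1 ^+ nu1_sum w else 0.
Proof. by rewrite ffunE. Qed.

(** This lets [Ften_uvec] and [jones_wenzl_uvec] hold without a bound on the index. *)
Lemma uvec_gt n k : (n < k)%N -> uvec n k = 0.
Proof.
move=> nk; apply/ffunP => w; rewrite !ffunE.
by case: eqP => // e; move: (nu1_count_le w); rewrite e leqNgt nk.
Qed.

Lemma uvec_n0 n : uvec n 0 = x0 K n.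
Proof.
apply/ffunP => w; rewrite !ffunE nu1_count_eq0; case: eqP => // ->.
rewrite nu1_sumE big1 ?expr0 // => j _.
by rewrite ffunE.
Qed.

Lemma uvec_cons0 n :
  uvec n.+1 0 = tensv (rho K (letter false)) (uvec n 0).
Proof.
apply/ffunP => w; rewrite !ffunE.
rewrite (nu1_count_lr (m := 1) (n := n) w) (nu1_sum_lr (m := 1) (n := n) w).
rewrite !letter_eq nu1_count1 nu1_sum1.
case: (lword _ _) => /=; first by rewrite mul0r.
rewrite mul1r !add0n mul1n; case: eqP => // ->.
by rewrite addn0.
Qed.

(** Prepending a letter moves every other position up by one. With nu_0 in front, k+1 letters move;
    with nu_1 in front, k letters move and position 1 is added. The exponent grows by k+1 either
    way. *)
Lemma uvec_consS n k :
  uvec n.+1 k.+1 =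
    q^-1 ^+ k.+1 *: tensv (rho K (letter false)) (uvec n k.+1)
    + q^-1 ^+ k.+1 *: tensv (rho K (letter true)) (uvec n k).
Proof.
apply/ffunP => w; rewrite !ffunE.
rewrite (nu1_count_lr (m := 1) (n := n) w) (nu1_sum_lr (m := 1) (n := n) w).
rewrite !letter_eq nu1_count1 nu1_sum1 /GRing.scale /=.
case: (lword _ _) => /=.
  rewrite mul0r mulr0 add0r mul1r mul1n eqSS; case: eqP => [->|]; last by rewrite mulr0.
  by rewrite -exprD; congr (_ ^+ _); lia.
rewrite mul0r mulr0 addr0 mul1r !add0n mul1n.
case: eqP => [->|]; last by rewrite mulr0.
by rewrite -exprD addnC.
Qed.

Lemma uvec_snoc0 n : uvec n.+1 0 = snocv (uvec n 0) false.
Proof.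
apply/ffunP => w; have [a [s ->]] := word_snoc w.
rewrite snocvE !uvecE count_snocw sum_snocw.
by case: s; rewrite /= ?addn1 // mul0n !addn0.
Qed.

(** Appending a letter moves no position, so the only new factor comes from a nu_1 at position
    n+1. *)
Lemma uvec_snocS n k :
  uvec n.+1 k.+1 =
    snocv (uvec n k.+1) false + q^-1 ^+ n.+1 *: snocv (uvec n k) true.
Proof.
apply/ffunP => w; have [a [s ->]] := word_snoc w.
rewrite [RHS]ffunE [X in _ + X]ffunE !snocvE !uvecE count_snocw sum_snocw.
rewrite /GRing.scale /=; case: s => /=.
  rewrite addn1 eqSS mul1n add0r; case: eqP => [_|]; rewrite ?mulr0 //.
  by rewrite -exprD addnC.
by rewrite mulr0 addr0 mul0n !addn0.
Qed.

Hypotheses (q0 : q != 0) (d0 : q - q^-1 != 0).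

Lemma qintD a b : qint q (a + b) = q^-1 ^+ b * qint q a + q ^+ a * qint q b.
Proof.
rewrite /qint exprVn exprD !mulrA -mulrDl; congr (_ / _).
have := expf_neq0 a q0; have := expf_neq0 b q0.
by move: (q ^+ a) (q ^+ b) => A B A0 B0; field; rewrite A0 B0.
Qed.

Lemma qint0 : qint q 0 = 0.
Proof. by rewrite /qint expr0 invr1 subrr mul0r. Qed.

Lemma qint1 : qint q 1 = 1.
Proof. by rewrite /qint expr1 divff. Qed.

Lemma qfact0 : qfact q 0 = 1.
Proof. by rewrite /qfact big_nil. Qed.

Lemma qfactS n : qfact q n.+1 = qfact q n * qint q n.+1.
Proof. by rewrite /qfact big_nat_recr. Qed.

Lemma qfact_neq0_le m n : (m <= n)%N -> qfact q n != 0 -> qfact q m != 0.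
Proof.
elim: n => [|n IHn]; first by rewrite leqn0 => /eqP ->.
rewrite leq_eqVlt => /predU1P[-> //|mn].
by rewrite qfactS mulf_eq0 negb_or => /andP[/IHn fm _]; apply: fm.
Qed.

Lemma lin_Ften n : linear (@Ften K q n).
Proof.
case: n => [|n] a u v /=; first by rewrite scaler0 addr0.
have e1 := @lin_tens K 1 1 n n (@F1 K) id a u v.
have e2 := @lin_tens K 1 1 n n (K1inv q) (@Ften K q n) a u v.
by rewrite e1 e2 scalerDr addrACA.
Qed.

Lemma Ften_cons n s (v : X K n) :
  Ften q (tensv (rho K (letter s)) v : X K n.+1)
  = (if s then 0 else tensv (rho K (letter true)) v)
    + (if s then q else q^-1) *: tensv (rho K (letter s)) (Ften q v).
Proof.
rewrite /= !tens_tensv; try exact: lin_lext; try exact: lin_Ften; try by [].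
rewrite /F1 /K1inv !lext_bvec ffunE tensvZl.
case: s => //; congr (_ + _).
by apply/ffunP => w; rewrite !ffunE mul0r.
Qed.

(** Induction on the number of factors through the first letter. The part beginning with nu_1 gets
    two contributions, which add up by [k+2] = q^-(k+1) [1] + q [k+1]. *)
Lemma Ften_uvec n k :
  Ften q (uvec n k) = (q ^+ k.+1 * qint q k.+1) *: uvec n k.+1.
Proof.
elim: n k => [|n IHn] k.
  by rewrite (uvec_gt (ltn0Sn k)) scaler0.
have FS (u v : X K n.+1) a b : Ften q (a *: u + b *: v) = a *: Ften q u + b *: Ften q v.
  by rewrite (@lin_Ften _ a) lin_scale; last exact: lin_Ften.
case: k => [|k]; rewrite uvec_consS.
  rewrite uvec_cons0 Ften_cons IHn tensvZr qint1 mulr1 !expr1 scalerDr !scalerA.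
  by rewrite divff // mulVf // !scale1r addrC.
rewrite uvec_consS FS !Ften_cons !IHn !tensvZr add0r !scalerDr !scalerA addrC addrA.
rewrite -scalerDl addrC; congr (_ *: _ + _ *: _).
  rewrite !exprS exprVn; have := expf_neq0 k q0; move: (q ^+ k) => Q Q0.
  by field; rewrite Q0 q0.
rewrite -(add1n k.+1) qintD qint1 !exprVn exprD expr1.
have := expf_neq0 k.+1 q0; move: (q ^+ k.+1) => Q Q0.
by field; rewrite Q0 q0.
Qed.

(** The factors q^j [j] for j = 1, ..., k multiply up, and 1 + ... + k is the binomial in the
    exponent. *)
Lemma Ften_iter n k :
  iter k (@Ften K q n) (x0 K n) = (q ^+ 'C(k.+1, 2) * qfact q k) *: uvec n k.
Proof.
elim: k => [|k IHk] /=; first by rewrite qfact0 mulr1 expr0 scale1r uvec_n0.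
rewrite IHk lin_scale ?Ften_uvec; last exact: lin_Ften.
by rewrite scalerA qfactS (binS k.+1) bin1 exprD; congr (_ *: _); ring.
Qed.

End WeightVectors.

Local Arguments jones_wenzl : simpl never.

(** * The Jones-Wenzl projection on weight vectors and on basis tensors *)

Section JonesWenzl.
Variables (K : fieldType) (q : K).
Hypotheses (q0 : q != 0) (d0 : q - q^-1 != 0).

Lemma lin_castop m n (e : m = n) (f : X K m -> X K m) :
  linear f -> linear (castop e f).
Proof.
by move=> hf a u v; rewrite /castop /= !(@lin_castX, hf).
Qed.

Lemma lin_add_strand n (f : X K n -> X K n) : linear (add_strand f).
Proof. exact/lin_castop/lin_tens. Qed.

Lemma lin_e_last n : linear (@e_last K q n).
Proof. exact/lin_castop/lin_tens. Qed.

Lemma jones_wenzlSS n (v : X K n.+2) :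
  let g := add_strand (@jones_wenzl K q n.+1) in
  jones_wenzl q v = g v - (qint q n.+1 / qint q n.+2) *: g (e_last q (g v)).
Proof. by []. Qed.

Lemma lin_jones_wenzl n : linear (@jones_wenzl K q n).
Proof.
case: n => [|[|n]] // a u v; rewrite !jones_wenzlSS.
set g := add_strand _; have hg : linear g by exact: lin_add_strand.
move: (_ / _) => c; rewrite hg lin_e_last hg.
move: (g u) (g v) (g (e_last _ _)) (g (e_last _ _)) => x y z t.
by rewrite scalerBr scalerDr opprD addrACA !scalerA [c * a]mulrC.
Qed.

Lemma add_strand_snocv n (f : X K n -> X K n) (v : X K n) s : linear f ->
  add_strand f (snocv v s) = snocv (f v) s.
Proof. by move=> hf; rewrite /add_strand /castop /= /snocv castXK tens_tensv. Qed.

Lemma snocw2 n (a : word n) s t :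
  castw (esym (addn2 n)) (snocw (snocw a s) t) = catw a (pair_word s t).
Proof.
apply/ffunP => j; rewrite [LHS]ffunE [RHS]ffunE; case: splitP => k jk.
  have kk : lift ord_max k = k :> nat by rewrite /= /bump leqNgt ltn_ord.
  rewrite (snocw_l _ _ (k := lift ord_max k)); last by rewrite kk.
  exact: snocw_l.
rewrite [RHS]ffunE; case: (eqVneq k ord0) => [k0|/eqP k1].
  rewrite (snocw_l _ _ (k := ord_max)); last by rewrite /= jk k0 addn0.
  by rewrite snocw_r.
have k1' : k = 1%N :> nat by case: k k1 {jk} => [[|[|[]]] //= h] []; apply: val_inj.
by rewrite snocw_r //= jk k1' addn1.
Qed.

Lemma snocv2 n (v : X K n) s t :
  snocv (snocv v s) t = castX (addn2 n) (tensv v (rho K (pair_word s t))).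
Proof.
apply/ffunP => w; have [w' [t' ->]] := word_snoc w; have [a [s' ->]] := word_snoc w'.
rewrite [RHS]castXE snocw2 !snocvE ffunE lword_catw rword_catw [rho _ _ _]ffunE.
have -> : (pair_word s' t' == pair_word s t) = (s' == s) && (t' == t).
  apply/eqP/andP => [/ffunP e|[/eqP-> /eqP->]] //.
  by move: (e ord0) (e ord_max); rewrite !ffunE /= => -> ->.
by case: (s' == s); case: (t' == t); rewrite /= ?mulr1 ?mulr0.
Qed.

Lemma e_last_snocv n (v : X K n) s t :
  e_last q (snocv (snocv v s) t) =
    cup_coef q s t *: (q^-1 *: snocv (snocv v true) false - snocv (snocv v false) true).
Proof.
rewrite !snocv2 /e_last /castop /= castXK tens_tensv //; last first.
  exact/lin_comp/lin_lext/lin_lext.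
rewrite /= /cup lext_bvec !ffunE /= lin_scale; last exact: lin_lext.
rewrite /cap lext_bvec tensvZr lin_scale; last exact: lin_castX.
congr (_ *: _).
by rewrite -scaleN1r !(tensvDr, tensvZr) addrC lin_castX
  lin_scale ?scaleN1r 1?addrC //; exact: lin_castX.
Qed.

(** When [N]! is nonzero, this is the inverse of the sum of q^(-2 s(b)) over the words b of length N
    with n letters nu_1, where s(b) is the position sum. This value is forced by f_N u_n = u_n. *)
Definition jw_coef N n : K :=
  q ^+ (n * N.+1) * (qfact q n * qfact q (N - n) / qfact q N).

(** Split u_n at its last letter: the two coefficients sum to 1 by [qintD]. The two formulas are
    hypotheses because the lemma serves inside the induction that establishes them. *)
Lemma jones_wenzl_uvec N n :
  qint q N.+1 != 0 ->
  (forall k, (k <= N.+1)%N -> jones_wenzl q (snocv (uvec q N k) false) =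
    (q ^+ k * qint q (N.+1 - k) / qint q N.+1) *: uvec q N.+1 k) ->
  (forall k, jones_wenzl q (snocv (uvec q N k) true) =
    (q ^+ k.+1 * qint q k.+1 / qint q N.+1) *: uvec q N.+1 k.+1) ->
  jones_wenzl q (uvec q N.+1 n) = uvec q N.+1 n.
Proof.
move=> iN H0 H1; have hf := @lin_jones_wenzl N.+1.
case: (ltnP N.+1 n) => [Nn|]; first by rewrite uvec_gt // lin_zero.
case: n => [_|n nN].
  by rewrite {1}uvec_snoc0 H0 // subn0 expr0 mul1r divff // scale1r.
rewrite {1}uvec_snocS lin_add // lin_scale // H0 // H1 scalerA -scalerDl.
rewrite -[RHS]scale1r; congr (_ *: _); apply: (@mulIf _ (qint q N.+1)) => //.
set m := (N.+1 - n.+1)%N; have Nm : (N.+1 = n.+1 + m)%N by rewrite /m; lia.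
have qN : qint q N.+1 = q^-1 ^+ m * qint q n.+1 + q ^+ n.+1 * qint q m.
  by rewrite Nm qintD.
have -> : q^-1 ^+ N.+1 = q^-1 ^+ n.+1 * q^-1 ^+ m by rewrite Nm exprD.
rewrite mul1r [RHS]qN !exprVn.
have := expf_neq0 n.+1 q0; have := expf_neq0 m q0; move: (q ^+ n.+1) (q ^+ m) => A B B0 A0.
by field; rewrite A0 B0 iN.
Qed.

(** One step of the recursion reduced to two scalar identities: [x] and [y] stand for the two halves
    of u_(n+1) split at its last letter, so [x + d *: y] is u_(n+1) itself. *)
Lemma lincomb (V : lmodType K) (x y : V) s t a b c d r :
  s - c * a = r -> t + c * b = r * d ->
  s *: x + t *: y - c *: (a *: x - b *: y) = r *: (x + d *: y).
Proof.
move=> e1 e2; rewrite scalerBr opprB [X in _ + X]addrC addrACA scalerDr !scalerA.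
by rewrite -scalerBl -scalerDl e1 e2.
Qed.

(* By induction f_{N+1} fixes every [uvec q N.+1 n], so the innermost factor of
   f_{N+2} = g - c g e g acts trivially on the vectors below. *)
Lemma jones_wenzl_snocv N : qfact q N.+1 != 0 ->
  (forall n, (n <= N.+1)%N -> jones_wenzl q (snocv (uvec q N n) false) =
    (q ^+ n * qint q (N.+1 - n) / qint q N.+1) *: uvec q N.+1 n) /\
  (forall n, jones_wenzl q (snocv (uvec q N n) true) =
    (q ^+ n.+1 * qint q n.+1 / qint q N.+1) *: uvec q N.+1 n.+1).
Proof.
elim: N => [|N IHN].
  move=> _; split=> n.
    case: n => [|[|//]] _.
      by rewrite subn0 expr0 mul1r divff ?qint1 ?oner_neq0 // scale1r uvec_snoc0.
    rewrite subnn qint0 mulr0 mul0r scale0r uvec_gt // snocv0.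
    exact/lin_zero/lin_jones_wenzl.
  case: n => [|n].
    rewrite expr1 mulfK ?qint1 ?oner_neq0 // uvec_snocS (uvec_gt q (n := 0) (k := 1)) // snocv0.
    by rewrite add0r scalerA expr1 divff // scale1r.
  rewrite (uvec_gt q (n := 1) (k := n.+2)) // scaler0 uvec_gt //.
  by rewrite snocv0; exact/lin_zero/lin_jones_wenzl.
rewrite qfactS mulf_eq0 negb_or => /andP[fN iN2].
have iN1 : qint q N.+1 != 0 by move: fN; rewrite qfactS mulf_eq0 negb_or => /andP[].
have [H0 H1] := IHN fN.
have hg : linear (add_strand (@jones_wenzl K q N.+1)) by exact: lin_add_strand.
have he := @lin_e_last N.
have gu n s : add_strand (@jones_wenzl K q N.+1) (snocv (uvec q N.+1 n) s)
    = snocv (uvec q N.+1 n) s.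
  by rewrite add_strand_snocv ?jones_wenzl_uvec //; exact: lin_jones_wenzl.
(* The argument is u_n followed by a cap, the shape that [e_last] produces; the formulas for f_(N+1)
   evaluate g on it. *)
have ge n : (n <= N.+1)%N ->
  add_strand (@jones_wenzl K q N.+1)
    (q^-1 *: snocv (snocv (uvec q N n) true) false - snocv (snocv (uvec q N n) false) true)
  = (q ^+ n * qint q n.+1 / qint q N.+1) *: snocv (uvec q N.+1 n.+1) false
    - (q ^+ n * qint q (N.+1 - n) / qint q N.+1) *: snocv (uvec q N.+1 n) true.
  move=> nN; rewrite lin_sub // lin_scale //.
  rewrite !add_strand_snocv; try exact: lin_jones_wenzl.
  rewrite H0 // H1 !snocvZ.
  by rewrite scalerA exprS !mulrA mulVf // mul1r.
have eN n : (n <= N.+1)%N ->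
    qint q N.+2 = q^-1 ^+ (N.+1 - n) * qint q n.+1 + q ^+ n.+1 * qint q (N.+1 - n).
  by move=> nN; rewrite -(qintD q0); congr qint; lia.
have e1 n : (n <= N.+1)%N -> q^-1 ^+ N.+1 = q^-1 ^+ n * q^-1 ^+ (N.+1 - n).
  by move=> nN; rewrite -exprD; congr (_ ^+ _); lia.
split=> n.
  case: n => [_|n nN].
    rewrite jones_wenzlSS /= gu {2}uvec_snoc0 e_last_snocv scale0r lin_zero // scaler0 subr0.
    by rewrite subn0 expr0 mul1r divff // scale1r [RHS]uvec_snoc0.
  (* The cup kills equal letters. As the last letter is nu_0, only the part of u_(n+1) ending in
     nu_1 survives. *)
  rewrite jones_wenzlSS /= gu {2}uvec_snocS snocvD snocvZ.
  rewrite (lin_add he) (lin_scale he) !e_last_snocv scale0r add0r scale1r.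
  rewrite (lin_scale hg) ge // subSS (uvec_snocS _ N.+1) scalerA.
  rewrite -[X in X - _]addr0 -(scale0r (snocv (uvec q N.+1 n) true)).
  rewrite -{1}[snocv (uvec q N.+1 n.+1) false]scale1r; apply: lincomb.
    apply: (@mulIf _ (qint q N.+2)) => //.
    rewrite mulrBl mul1r {1}(eN n) // (e1 n) // exprS !exprVn.
    have := expf_neq0 n q0; have := expf_neq0 (N.+1 - n) q0; move: (q ^+ n) (q ^+ _) => A B B0 A0.
    by field; rewrite A0 B0 iN1 iN2.
  rewrite (exprS _ N.+1) (e1 n) // !exprS !exprVn.
  have := expf_neq0 n q0; have := expf_neq0 (N.+1 - n) q0; move: (q ^+ n) (q ^+ _) => A B B0 A0.
  by field; rewrite A0 B0 iN1 iN2 q0.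
case: (ltnP N.+1 n) => [Nn|nN].
  rewrite uvec_gt // snocv0 uvec_gt // scaler0; exact/lin_zero/lin_jones_wenzl.
(* Now the last letter is nu_1, so only the part of u_n ending in nu_0 survives, with cup value
   -q. *)
have ev : e_last q (snocv (uvec q N.+1 n) true)
    = - q *: (q^-1 *: snocv (snocv (uvec q N n) true) false
              - snocv (snocv (uvec q N n) false) true).
  case: n nN => [_|n nN]; first by rewrite uvec_snoc0 e_last_snocv.
  by rewrite uvec_snocS snocvD snocvZ (lin_add he) (lin_scale he) !e_last_snocv
    scale0r scaler0 addr0.
rewrite jones_wenzlSS /= gu ev (lin_scale hg) ge // (uvec_snocS _ N.+1) scalerA.
rewrite -[X in X - _]add0r -(scale0r (snocv (uvec q N.+1 n.+1) false)).
rewrite -{1}[snocv (uvec q N.+1 n) true]scale1r; apply: lincomb.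
  by rewrite exprS; field; rewrite iN1 iN2.
apply: (@mulIf _ (qint q N.+2)) => //.
rewrite mulrDl mul1r {1}(eN n) // (exprS q^-1 N.+1) (e1 n) // exprS !exprVn.
have := expf_neq0 n q0; have := expf_neq0 (N.+1 - n) q0; move: (q ^+ n) (q ^+ _) => A B B0 A0.
by field; rewrite A0 B0 iN1 iN2 q0.
Qed.

(** Induction on N, removing the last letter of [b]: the shorter projection replaces the remaining
    word by a multiple of u_n, and [jones_wenzl_snocv] finishes. *)
Lemma jones_wenzl_rho N (b : word N) : qfact q N != 0 ->
  jones_wenzl q (rho K b)
  = (q^-1 ^+ nu1_sum b * jw_coef N (nu1_count b)) *: uvec q N (nu1_count b).
Proof.
elim: N b => [|[|N] IHN] b fN.
- have c0 (w : word 0) : nu1_count w = 0%N by rewrite nu1_countE big_ord0.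
  have s0 (w : word 0) : nu1_sum w = 0%N by rewrite nu1_sumE big_ord0.
  have wb (w : word 0) : w = b by apply/ffunP => -[].
  rewrite c0 s0 /jw_coef mul0n qfact0 !expr0 !mul1r invr1 scale1r.
  by apply/ffunP => w; rewrite [RHS]uvecE ffunE (wb w) c0 s0 !eqxx.
- rewrite -[LHS]/(rho K b); apply/ffunP => w; rewrite [RHS]ffunE uvecE [LHS]ffunE /jw_coef.
  rewrite !nu1_count1 !nu1_sum1 (word1E b) (word1E w) -/(letter _) letter_eq !ffunE.
  rewrite !qfactS !qfact0 !qint1 // /GRing.scale /=.
  case: (w ord0) (b ord0) => [] [] /=; rewrite ?mulr0 //.
    by rewrite subnn qfact0 qfactS qfact0 qint1 // mul1n !expr1; field; rewrite q0 oner_neq0.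
  by rewrite subn0 qfact0 qfactS qfact0 qint1 // mul0n !expr0; field; rewrite oner_neq0.
have [fN1 iN2] : qfact q N.+1 != 0 /\ qint q N.+2 != 0.
  by apply/andP; rewrite -negb_or -mulf_eq0 -qfactS.
have iN1 : qint q N.+1 != 0 by move: fN1; rewrite qfactS mulf_eq0 negb_or => /andP[].
have {}IHN b' := IHN b' fN1.
have [a [s ->]] := word_snoc b; have := nu1_count_le a.
rewrite count_snocw sum_snocw -snocv_rho; set n := nu1_count a => nN.
set u := uvec q N.+1 n.
have fu : jones_wenzl q u = u by have [? ?] := jones_wenzl_snocv fN1; exact: jones_wenzl_uvec.
(* f_(N+2) depends on its argument only through its image under g = f_(N+1) (x) 1, and g has
   proportional images on [snocv (rho K a) s] and [snocv u s], since f_(N+1) fixes [u]. *)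
have -> : jones_wenzl q (snocv (rho K a) s) =
    (q^-1 ^+ nu1_sum a * jw_coef N.+1 n) *: jones_wenzl q (snocv u s).
  rewrite !jones_wenzlSS /= !add_strand_snocv; try exact: lin_jones_wenzl.
  rewrite fu IHN -/n -/u snocvZ (lin_scale (@lin_e_last _)) (lin_scale (lin_add_strand _)).
  by rewrite scalerBr !scalerA; congr (_ - _ *: _); ring.
have [H0 H1] := jones_wenzl_snocv fN.
have fN0 := qfact_neq0_le (leqnSn N) fN1; have nz k := expf_neq0 k q0.
rewrite /jw_coef; case: s.
  rewrite H1 scalerA mul1n addn1 subSS !qfactS exprD mulrA; congr (_ *: _).
  rewrite (_ : (n.+1 * N.+3 = n * N.+2 + n.+1 + N.+2)%N); last by lia.
  rewrite !exprD !exprVn; have := nz N.+2.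
  have := nz (nu1_sum a); move: (q ^+ N.+2) (q ^+ nu1_sum a) => Q S S0 Q0; field.
  by rewrite iN2 iN1 fN0 Q0 S0.
rewrite H0; last by lia.
rewrite -[nat_of_bool false]/0%N scalerA mul0n !addn0 (subSn nN).
rewrite (qfactS _ (N.+1 - n)) (qfactS _ N.+1); congr (_ *: _).
rewrite (mulnS n N.+2) exprD.
by field; rewrite iN2 fN1.
Qed.

End JonesWenzl.

(** * Evaluation of the nested cup *)

Section Diagram.
Variables (K : fieldType) (q : K).

Definition rcword M (b : word M) : word M := [ffun k => ~~ b (rev_ord k)].

(** A pair of equal letters gives 0, so the paired words must be reversed complements. Then each
    nu_1 of [b] contributes -q and each nu_0 contributes 1. *)
Lemma prod_cup_coef M (b c : word M) :
  \prod_(k < M) cup_coef q (c k) (b (rev_ord k))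
  = if c == rcword b then (- q) ^+ nu1_count b else 0.
Proof.
case: eqP => [->|cb].
  rewrite nu1_countE -prodrXr (reindex_inj rev_ord_inj) /=.
  by apply: eq_bigr => k _; rewrite ffunE rev_ordK; case: (b k).
case: (pickP (fun k => c k == b (rev_ord k))) => [k /eqP ck|nc].
  by rewrite (bigD1 k) //= ck; case: (b _); rewrite mul0r.
case: cb; apply/ffunP => k; rewrite ffunE.
by move: (nc k); case: (c k); case: (b _).
Qed.

Lemma count_rcword M (b : word M) : (nu1_count (rcword b) + nu1_count b = M)%N.
Proof.
rewrite !nu1_countE [X in (X + _)%N](reindex_inj rev_ord_inj) -big_split /=.
rewrite (eq_bigr (fun=> 1%N)) => [|k _]; first by rewrite sum1_card card_ord.
by rewrite ffunE rev_ordK; case: (b k).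
Qed.

(** A nu_1 of [b] at position j removes M+1-j from the total of all positions. The identity is kept
    additive to avoid truncated subtraction. *)
Lemma sum_rcword M (b : word M) :
  (nu1_sum (rcword b) + M.+1 * nu1_count b = \sum_(k < M) (M - k) + nu1_sum b)%N.
Proof.
rewrite !nu1_sumE !nu1_countE [X in (X + _)%N](reindex_inj rev_ord_inj) big_distrr.
rewrite -!big_split; apply: eq_bigr => k _ /=; rewrite ffunE rev_ordK.
by have := ltn_ord k; case: (b k); lia.
Qed.

Lemma tens_idE m n n' (g : X K n -> X K n') (V : X K (m + n)) (y : word (m + n')) :
  tens (m := m) (m' := m) id g V y
  = \sum_b (V (catw (lword y) b) : K) * g (rho K b) (rword y).
Proof.
rewrite /tens /lext sum_word_cat exchange_big sum_ffunE; apply: eq_bigr => b _.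
rewrite sum_ffunE (bigD1 (lword y)) //= big1 => [|a ay].
  by rewrite addr0 !ffunE lword_catw rword_catw eqxx mul1r.
by rewrite !ffunE lword_catw eq_sym (negPf ay) mul0r scaler0.
Qed.

Lemma castw_catA m n p (e : (m + n + p = m + (n + p))%N) (a : word m) (b : word n) (c : word p) :
  castw (esym e) (catw a (catw b c)) = catw (catw a b) c.
Proof.
apply/ffunP => j; rewrite [LHS]ffunE [LHS]ffunE [RHS]ffunE.
case: splitP => k /= jk; case: splitP => l jl.
- rewrite ffunE; case: splitP => h lh; first by congr (a _); apply: val_inj => /=; lia.
  by have := ltn_ord k; lia.
- by have := ltn_ord k; have := ltn_ord l; lia.
- rewrite ffunE [RHS]ffunE; case: splitP => h kh; case: splitP => h' lh.
  + by have := ltn_ord h'; lia.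
  + by congr (b _); apply: val_inj => /=; lia.
  + by have := ltn_ord l; lia.
  + by have := ltn_ord l; lia.
- rewrite ffunE; case: splitP => h kh; first by have := ltn_ord h; lia.
  by congr (c _); apply: val_inj => /=; lia.
Qed.

(** In the sum over middle and right words a single term survives: right word [b], middle word
    [rcword b]. What remains is the coefficient of u_n at [w] followed by [rcword b], whose
    positions are shifted by [m]. *)
Lemma diagram_rho m M P (e : (P + M = m + (M + M))%N) (f : X K P -> X K P)
    (x : word (P + M)) (c : K) n (w : word m) :
  f (rho K (lword x)) = c *: uvec q P n ->
  castX (addn0 m) (tens (m := m) (m' := m) id (@nested_cup K q M)
    (castX e (tens (n := M) (n' := M) f id (rho K x)))) w =
  if (nu1_count w + nu1_count (rcword (rword x)) == n)%N
  then c * (- q) ^+ nu1_count (rword x)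
       * q^-1 ^+ (nu1_sum w + nu1_sum (rcword (rword x))
                  + m * nu1_count (rcword (rword x)))
  else 0.
Proof.
move=> fx; rewrite tens_rho fx castXE; set b := rword x.
have ePm : P = (m + M)%N by lia.
subst P; rewrite tens_idE sum_word_cat.
set y := castw _ w.
have c0 (v : word 0) : nu1_count v = 0%N by rewrite nu1_countE big_ord0.
have s0 (v : word 0) : nu1_sum v = 0%N by rewrite nu1_sumE big_ord0.
have -> : nu1_count w = nu1_count (lword y).
  by rewrite -(count_castw (esym (addn0 m)) w) -/y nu1_count_lr c0 addn0.
have -> : nu1_sum w = nu1_sum (lword y).
  by rewrite -(sum_castw (esym (addn0 m)) w) -/y nu1_sum_lr c0 s0 muln0 !addn0.
have V c' d : castX e (tensv (c *: uvec q (m + M) n) (rho K b)) (catw (lword y) (catw c' d))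
   = c * uvec q (m + M) n (catw (lword y) c') * (d == b)%:R.
  by rewrite castXE castw_catA ffunE lword_catw rword_catw ffunE [rho _ _ _]ffunE.
have N c' : nested_cup q (rho K (catw c' b)) (rword y)
    = if c' == rcword b then (- q) ^+ nu1_count b else 0.
  rewrite /nested_cup lext_bvec ffunE -prod_cup_coef ffunE.
  have -> : rword y == [ffun=> false] by rewrite -nu1_count_eq0 c0.
  rewrite /GRing.scale /= mulr1; apply: eq_bigr => k _.
  by rewrite catw_lshift catw_rshift.
rewrite (bigD1 (rcword b)) //= [X in _ + X]big1 => [|c' cb]; last first.
  rewrite big1 // => d _; rewrite V.
  by case: eqP => [->|_]; rewrite ?mulr0 ?mul0r // N (negPf cb) mulr0.
rewrite addr0 (bigD1 b) //= big1 => [|d db]; last by rewrite V (negPf db) mulr0 mul0r.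
rewrite addr0 V N !eqxx mulr1 uvecE nu1_count_lr nu1_sum_lr lword_catw rword_catw.
by case: eqP => _; rewrite ?mulr0 ?mul0r // mulrAC.
Qed.

End Diagram.

(** * Quantum integers at a root of unity *)

Section RootOfUnity.
Variables (K : fieldType) (q : K) (p : nat).
Hypotheses (hp : (2 <= p)%N) (qp : q ^+ p = -1).
Hypothesis q_prim : forall k, (0 < k < p)%N -> q ^+ k ^+ 2 != 1.

Lemma q_neq0 : q != 0.
Proof.
apply: contra_eq_neq qp => ->; rewrite expr0n; case: p hp => // p' _.
by rewrite eq_sym oppr_eq0 oner_neq0.
Qed.

Lemma exprN_neq0 k : (0 < k < p)%N -> q ^+ k - q ^- k != 0.
Proof.
move=> kp; have Q0 := expf_neq0 k q_neq0.
apply: contraNneq (q_prim kp) => /subr0_eq e.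
by rewrite expr2 {2}e divff.
Qed.

Lemma subqV_neq0 : q - q^-1 != 0.
Proof. by apply: (@exprN_neq0 1); lia. Qed.

Lemma qint_neq0 k : (0 < k < p)%N -> qint q k != 0.
Proof.
by move=> kp; rewrite mulf_neq0 ?exprN_neq0 // invr_eq0 subqV_neq0.
Qed.

Lemma qfact_neq0 k : (k < p)%N -> qfact q k != 0.
Proof.
elim: k => [|k IHk] kp; first by rewrite qfact0 oner_neq0.
by rewrite qfactS mulf_neq0 ?qint_neq0 // IHk // ltnW.
Qed.

Lemma qint_sub k : (k <= p)%N -> qint q (p - k) = qint q k.
Proof.
move=> kp; rewrite /qint; congr (_ / _).
have -> : q ^+ (p - k) = - q ^- k.
  apply: (@mulIf _ (q ^+ k)); first by rewrite expf_neq0 ?q_neq0.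
  by rewrite -exprD subnK // qp mulNr mulVf // expf_neq0 ?q_neq0.
by rewrite invrN invrK opprK addrC.
Qed.

(** Passing from n to n+1 gains the factor [n+1] and loses [p-1-n], and these are equal by
    [qint_sub]. *)
Lemma qfact_compl n : (n < p)%N ->
  qfact q n * qfact q (p - 1 - n) = qfact q (p - 1).
Proof.
elim: n => [|n IHn] np; first by rewrite qfact0 mul1r subn0.
rewrite -IHn; last by lia.
have -> : (p - 1 - n = (p - 1 - n.+1).+1)%N by lia.
rewrite !qfactS; have -> : qint q (p - 1 - n.+1).+1 = qint q n.+1.
  by rewrite -(qint_sub (ltnW np)); congr qint; lia.
by rewrite mulrAC !mulrA.
Qed.

End RootOfUnity.

(** * The last two maps composing theta *)

Section Theta.
Variables (K : fieldType) (q : K) (p i : nat).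

Lemma lin_P_to_S : linear (@P_to_S K q p i). Proof. exact: lin_lext. Qed.
Lemma lin_S_to_X : linear (@S_to_X K q i). Proof. exact: lin_lext. Qed.

(** Removes the ambiguity in the projection, whose values are prescribed only modulo this span. *)
Lemma P_to_S_span u : in_span_axy u -> @P_to_S K q p i u = 0.
Proof.
case=> al [xi [et ->]]; rewrite /P_to_S /lext big1 // => -[[k|k]|s] _; rewrite ?scaler0 //.
rewrite !ffunE !sum_ffunE !big1 ?addr0 ?scale0r // => j _; by rewrite !ffunE scaler0.
Qed.

Lemma P_to_S_b k : (k < i)%N -> @P_to_S K q p i (bbvec K p i k) = zvec K i k.
Proof.
move=> ki; have -> : bbvec K p i k = bvec K (inl (inr (Ordinal ki)) : Pbasis p i).
  by apply/ffunP => -[[j|j]|[j|j]]; rewrite !ffunE.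
by rewrite /P_to_S lext_bvec.
Qed.

Lemma S_to_X_z k : (k < i)%N ->
  @S_to_X K q i (zvec K i k) = iter k (@Ften K q (i - 1)) (x0 K (i - 1)).
Proof.
move=> ki; have -> : zvec K i k = bvec K (Ordinal ki).
  by apply/ffunP => j; rewrite !ffunE.
by rewrite /S_to_X lext_bvec.
Qed.

End Theta.

(** * Comparison of the two operators on basis tensors *)

Lemma bin2_double n : (2 * 'C(n.+1, 2) = n.+1 * n)%N.
Proof.
by elim: n => // n IHn; rewrite binS bin1 mulnDr IHn; lia.
Qed.

(** The bookkeeping of powers of q in [theta_rho], with m = p-i and n the index of the vector b_n
    hit by the projection. *)
Lemma bin2_shift m n : (0 < m)%N ->
  ((n + m) * m.-1 + 'C(n.+1, 2) = 'C(m, 2) + 'C(n + m, 2))%N.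
Proof.
case: m => // m _; have := bin2_double n; have := bin2_double m.
by rewrite addnS; have := bin2_double (n + m); nia.
Qed.

Section Comparison.
Variables (K : fieldType) (q : K) (p i : nat).
Hypotheses (hp : (2 <= p)%N) (hi : (1 <= i <= p - 1)%N) (qp : q ^+ p = -1).
Hypothesis q_prim : forall k, (0 < k < p)%N -> q ^+ k ^+ 2 != 1.

(** The shared value of both operators on [rho K w], stripped of the constants independent of
    [w]. *)
Definition common (w : word (2 * p - i - 1)) : X K (i - 1) :=
  if (p - i <= nu1_count w <= p - 1)%N
  then ((-1) ^+ nu1_count w * q^-1 ^+ nu1_sum w) *: uvec q (i - 1) (nu1_count w - (p - i))
  else 0.

Definition theta_const : K :=
  (-1) ^+ (p - i - 1) * q ^+ 'C(p - i, 2)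
  * (qfact q (p - 1) / (qfact q (i - 1) * qfact q (p - i - 1) ^+ 2)).

(** The exponent of q^-1 is the sum of the positions i, ..., p-1 of the p-i middle strands. *)
Definition diagram_const : K :=
  q^-1 ^+ (\sum_(k < p - i) (p - i - k) + (i - 1) * (p - i)).

Let q0 : q != 0 := q_neq0 hp qp.
Let d0 : q - q^-1 != 0 := subqV_neq0 hp qp q_prim.

Lemma theta_rho (phi : {linear Xmod q (2 * p - i - 1) -> Pmod q p i})
    (hphi : is_projection phi) (w : word (2 * p - i - 1)) :
  theta phi (rho K w) = theta_const *: common w.
Proof.
case: hphi => _ /(_ w); set n := nu1_count w => hspan.
rewrite /theta /= -[phi (rho K w)](subrK (if (p - i <= n <= p - 1)%N then
  proj_coef q w *: bbvec K p i (n + i - p) else 0)).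
rewrite (lin_add (@lin_P_to_S _ _ _ _)) (P_to_S_span q hspan) add0r /common -/n.
case: ifP => hn; last first.
  by rewrite (lin_zero (@lin_P_to_S _ _ _ _)) (lin_zero (@lin_S_to_X _ _ _)) scaler0.
have hm : (n + i - p < i)%N by lia.
rewrite (lin_scale (@lin_P_to_S _ _ _ _)) (lin_scale (@lin_S_to_X _ _ _)).
rewrite P_to_S_b // S_to_X_z // Ften_iter // !scalerA.
have em : (n - (p - i) = n + i - p)%N by lia.
rewrite em; congr (_ *: _).
rewrite /proj_coef /theta_const -/n (subnAC p n 1%N) qfact_compl ?hp //; last by lia.
have en : ((n ^ 2 - n) %/ 2 = 'C(n, 2))%N.
  by rewrite bin2 divn2; congr (_./2); case: (n) => // n'; lia.
(* Writing 2p-i-1 = p + (p-i-1) splits off q^(pn) = (-1)^n; the remaining exponents match by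
   [bin2_shift]. *)
have qe : q ^ ((n * (2 * p - i - 1))%N%:Z - ((n ^ 2 - n) %/ 2)%N%:Z - (nu1_sum w)%:Z)
    * q ^+ 'C((n + i - p).+1, 2) = q ^+ 'C(p - i, 2) * (-1) ^+ n * q^-1 ^+ nu1_sum w.
  rewrite en -qp -exprM exprVn exprnN !exprnP -!expfzDr //; congr (q ^ _).
  have := @bin2_shift (p - i) (n + i - p).
  have -> : (n + i - p + (p - i) = n)%N by lia.
  have -> : (n * (2 * p - i - 1) = p * n + n * (p - i).-1)%N.
    have -> : (2 * p - i - 1 = p + (p - i).-1)%N by lia.
    by rewrite mulnDr mulnC.
  by lia.
have f1 : qfact q (n + i - p) != 0 by apply: (qfact_neq0 hp qp q_prim); lia.
have f2 : qfact q (i - 1) != 0 by apply: (qfact_neq0 hp qp q_prim); lia.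
have f3 : qfact q (p - i - 1) != 0 by apply: (qfact_neq0 hp qp q_prim); lia.
set g := _ / (qfact q (i - 1) * _).
have -> : (-1) ^+ (p - i - 1) * q ^+ 'C(p - i, 2) * g * ((-1) ^+ n * q^-1 ^+ nu1_sum w)
    = (-1) ^+ (p - i - 1) * g * (q ^+ 'C(p - i, 2) * (-1) ^+ n * q^-1 ^+ nu1_sum w).
  by ring.
rewrite -qe /g; move: (q ^ _) (q ^+ _) (qfact q (p - 1)) ((-1) ^+ _) => Z Q F s.
by field; rewrite f1 f2 f3.
Qed.

Lemma theta_diagram_rho (w : word (2 * p - i - 1)) :
  theta_diagram q hi (rho K w) = diagram_const *: common w.
Proof.
rewrite /theta_diagram /= castX_rho; set x := castw _ w.
have fP : qfact q (p - 1) != 0 by apply: (qfact_neq0 hp qp q_prim); lia.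
have := jones_wenzl_rho q0 d0 (lword x) fP.
set a := lword x; set b := rword x => fa.
apply/ffunP => v; rewrite (diagram_rho _ _ fa) -/b.
have en : nu1_count w = (nu1_count a + nu1_count b)%N.
  by rewrite -(count_castw (source_size hi) w) nu1_count_lr.
have es : nu1_sum w = (nu1_sum a + nu1_sum b + (p - 1) * nu1_count b)%N.
  by rewrite -(sum_castw (source_size hi) w) nu1_sum_lr.
have cr := count_rcword b; have sr := sum_rcword b.
have ca := nu1_count_le a; have cv := nu1_count_le v.
rewrite [RHS]ffunE /common en es.
(* By [count_rcword] the condition says that [v] has n-(p-i) letters nu_1, n being the count of [w].
   As [v] has length i-1, it forces the range condition in [common]. *)
case: ifP => [/eqP ev|ev]; last first.
  case: ifP => hn; last by rewrite ffunE [RHS]mulr0.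
  rewrite ffunE uvecE ifF; first by rewrite /GRing.scale /= !mulr0.
  by lia.
rewrite ifT; last by lia.
rewrite ffunE uvecE ifT; last by lia.
rewrite /GRing.scale /= /diagram_const.
set T := (\sum_k _)%N in sr *.
(* For N = p-1 the factorials cancel by [qfact_compl] and q^p = -1, so [jw_coef] is just the sign
   given by the count of [a]. *)
rewrite /jw_coef.
rewrite qfact_compl //; last by lia.
rewrite divff // mulr1 (_ : (p - 1).+1 = p); last by lia.
rewrite mulnC exprM qp [(- q) ^+ _]exprNn.
(* Since q^(2p) = 1, the q in (-q)^(count of b) becomes a natural power of q^-1, so that all
   exponents can be compared as natural numbers. *)
have qV : q = q^-1 ^+ (2 * p - 1).
  apply: (@mulIf _ q^-1); first by rewrite invr_eq0.
  rewrite divff // -exprSr (_ : (2 * p - 1).+1 = p * 2)%N; last by lia.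
  by rewrite exprVn exprM qp sqrrN expr1n invr1.
rewrite {2}qV -exprM.
transitivity ((-1) ^+ nu1_count a * (-1) ^+ nu1_count b *
  q^-1 ^+ (nu1_sum a + (2 * p - 1) * nu1_count b
           + (nu1_sum v + nu1_sum (rcword b) + (i - 1) * nu1_count (rcword b)))).
  move: (nu1_sum v + _ + _)%N (_ * nu1_count b)%N => y z; rewrite !exprD.
  move: (_ ^+ nu1_sum a) (_ ^+ y) (_ ^+ z) ((-1) ^+ _) ((-1) ^+ _) => A Y Z s t.
  by ring.
rewrite (_ : (_ + _ + _ = (T + (i - 1) * (p - i))
    + (nu1_sum a + nu1_sum b + (p - 1) * nu1_count b) + nu1_sum v)%N).
  rewrite -exprD (exprD _ _ (nu1_sum v)) (exprD q^-1 (T + _)).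
  by rewrite -!mulrA [RHS]mulrCA.
(* These two expansions make the exponent identity linear in the products involved; [sum_rcword]
   then closes it. *)
have e2 : ((i - 1) * (p - i) = (i - 1) * nu1_count (rcword b) + (i - 1) * nu1_count b)%N.
  by rewrite -mulnDr cr.
have e1 : ((2 * p - 1) * nu1_count b
    = (p - i).+1 * nu1_count b + (i - 1) * nu1_count b + (p - 1) * nu1_count b)%N.
  by rewrite -!mulnDl; congr muln; lia.
by rewrite e1 e2; lia.
Qed.

Lemma lin_theta_diagram : linear (@theta_diagram K q p i hi).
Proof.
by rewrite /theta_diagram; do !apply: lin_comp; (exact: lin_castX || exact: lin_tens).
Qed.

End Comparison.

(** * The complex number exp(i pi / p) *)

Section ExpIPi.
Variables (R : realType) (p : nat).
Hypothesis hp : (2 <= p)%N.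

Lemma exp_i_pi_overX n :
  exp_i_pi_over R p ^+ n = Complex (cos (n%:R * (pi / p%:R))) (sin (n%:R * (pi / p%:R))).
Proof.
elim: n => [|n IHn]; first by rewrite mul0r cos0 sin0 expr0.
rewrite exprS IHn -natr1 [(_ + 1) * _]mulrDl mul1r cosD sinD /exp_i_pi_over.
by apply/eqP; rewrite eq_complex /=; apply/andP; split; apply/eqP; ring.
Qed.

Let p_gt0 : (0 < p)%N. Proof. exact: ltnW. Qed.

Lemma exp_i_pi_over_expp : exp_i_pi_over R p ^+ p = -1.
Proof.
rewrite exp_i_pi_overX mulrCA divff ?mulr1 ?pnatr_eq0 -?lt0n // cospi sinpi.
by apply/eqP; rewrite eq_complex /= oppr0 !eqxx.
Qed.

(** For 0 < n < p the imaginary part sin(n pi / p) is positive, so the n-th power is neither 1 nor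
    -1. *)
Lemma exp_i_pi_over_prim n : (0 < n < p)%N -> exp_i_pi_over R p ^+ n ^+ 2 != 1.
Proof.
move=> /andP[n0 np]; rewrite sqrf_eq1 exp_i_pi_overX.
have : 0 < sin (n%:R * (pi / p%:R)) :> R.
  rewrite sin_gt0_pi // mulr_gt0 ?divr_gt0 ?pi_gt0 ?ltr0n //=.
  by rewrite mulrA ltr_pdivrMr ?ltr0n // mulrC ltr_pM2l ?pi_gt0 // ltr_nat.
move=> s0; rewrite negb_or !eq_complex /= oppr0 !negb_and.
by rewrite (gt_eqF s0) !orbT.
Qed.

End ExpIPi.

Theorem proposition4p1 (R : realType) (k K : fieldType)
    (toC : {rmorphism k -> R[i]}) (toK : {rmorphism k -> K}) (q0 : k)
    (p i : nat) (hp : (2 <= p)%N) (hi : (1 <= i <= p - 1)%N)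
    (hq : toC q0 = exp_i_pi_over R p)
    (phi : {linear Xmod (toK q0) (2 * p - i - 1) -> Pmod (toK q0) p i})
    (hphi : is_projection phi) :
  exists2 c : K, c != 0 &
    forall v : X K (2 * p - i - 1),
      theta_diagram (toK q0) hi v = c *: theta phi v.
Proof.
(* Both facts about q are polynomial relations in [q0] over the common subfield. They come back from
   the complex numbers and go on to [K] because field morphisms are injective. *)
have qp : toK q0 ^+ p = -1.
  rewrite -rmorphXn -(rmorphN1 toK); congr (toK _).
  apply: (fmorph_inj toC); rewrite rmorphXn rmorphN1 hq.
  exact: exp_i_pi_over_expp.
have q_prim k' : (0 < k' < p)%N -> toK q0 ^+ k' ^+ 2 != 1.
  move=> hk; rewrite -!rmorphXn fmorph_eq1 -(fmorph_eq1 toC) !rmorphXn hq.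
  exact: exp_i_pi_over_prim.
set q := toK q0 in phi hphi qp q_prim *.
have nz n : (n < p)%N -> qfact q n != 0 by exact: qfact_neq0.
have q_nz : q != 0 by exact: q_neq0 qp.
have d1 : diagram_const q p i != 0 by rewrite expf_neq0 ?invr_eq0.
have t1 : theta_const q p i != 0.
  rewrite !(mulf_neq0, invr_eq0, expf_neq0, oppr_eq0, oner_neq0) ?nz //; lia.
exists (diagram_const q p i / theta_const q p i); first by rewrite mulf_neq0 ?invr_eq0.
move=> v; have lt : linear (theta phi).
  exact: (lin_comp (lin_comp (@lin_S_to_X _ _ _) (@lin_P_to_S _ _ _ _))
    (fun a x y => linearP phi a x y)).
(* By linearity it is enough to compare the two operators on basis tensors, where both are multiples
   of [common]. *)
rewrite (lin_expand v lt) (lin_expand v (@lin_theta_diagram K q p i hi)) scaler_sumr.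
apply: eq_bigr => w _; rewrite scalerA mulrC -scalerA; congr (_ *: _).
by rewrite theta_diagram_rho // theta_rho // scalerA divfK.
Qed.
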